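(* Let $k\geq 1$ and $n\geq 3$ be integers. If $n\leq 2k+1$, then $\operatorname{depth}(S/I(C_n^k))=1$. If $n\geq 2k+2$, then: (i) if $n\equiv 0,k+1,k+2,\dots,2k \pmod{2k+1}$, then $\operatorname{depth}(S/I(C_n^k))=\left\lceil\frac{n}{2k+1}\right\rceil$; (ii) if $n\equiv 1,2,\dots,k\pmod{2k+1}$, then $\left\lceil\frac{n}{2k+1}\right\rceil-1\leq\operatorname{depth}(S/I(C_n^k))\leq\left\lceil\frac{n}{2k+1}\right\rceil$.
   Context: $K$ is a field and $S=K[x_1,\dots,x_n]$ is the polynomial ring. $C_n^k$ denotes the $k$-th power of the cycle on the vertex set $\{1,\dots,n\}$ ($n\ge 3$): for $1\le i<j\le n$, $\{i,j\}$ is an edge if and only if $j-i\le k$ or $j-i\ge n-k$ (so $C_n^k$ is the complete graph when $n\le 2k+1$). Its edge ideal $I(C_n^k)\subset S$ is the squarefree monomial ideal generated by all $x_ix_j$ with $\{i,j\}$ an edge of $C_n^k$. Depth is taken with respect to the graded maximal ideal $(x_1,\dots,x_n)$. *)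

(* Defs.v *)
From mathcomp Require Export all_boot all_order all_algebra.
From mathcomp Require Export mpoly.

Set Implicit Arguments.
Unset Strict Implicit.
Unset Printing Implicit Defensive.

Import GRing.Theory.
Local Open Scope ring_scope.

Definition ideal_gen (S : comNzRingType) (G : S -> Prop) : S -> Prop :=
  fun p => exists s : seq (S * S),
    (forall x, x \in s -> G x.2) /\ p = \sum_(x <- s) x.1 * x.2.

(* The ideal I + (f_1, ..., f_r). *)
Definition ideal_add (S : comNzRingType) (I : S -> Prop) (fs : seq S) :
  S -> Prop := ideal_gen (fun p => I p \/ p \in fs).

(* f_1, ..., f_r is regular on the module M = S/I: f_{i+1} is a nonzerodivisor
   on M/(f_1, ..., f_i)M = S/(I + (f_1, ..., f_i)) for all i < r, and
   M/(f_1, ..., f_r)M = S/(I + (f_1, ..., f_r)) is nonzero. *)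
Definition regular_seq_quot (S : comNzRingType) (I : S -> Prop) (fs : seq S) :
  Prop :=
  (forall i : nat, (i < size fs)%N -> forall g : S,
     ideal_add I (take i fs) (fs`_i * g) -> ideal_add I (take i fs) g)
  /\ ~ ideal_add I fs 1.

(* depth_quot m I d: the depth of S/I with respect to m is d, that is, d is the
   maximal length of a sequence of elements of m that is regular on S/I. *)
Definition depth_quot (S : comNzRingType) (m I : S -> Prop) (d : nat) : Prop :=
  (exists fs : seq S,
     [/\ size fs = d, forall f, f \in fs -> m f & regular_seq_quot I fs])
  /\ (forall fs : seq S,
        (forall f, f \in fs -> m f) -> regular_seq_quot I fs ->
        (size fs <= d)%N).

Definition graded_maxideal (K : fieldType) (n : nat) : {mpoly K[n]} -> Prop :=
  ideal_gen (fun p => exists i : 'I_n, p = 'X_i).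

Definition edge_ideal (K : fieldType) (n : nat) (e : rel 'I_n) :
  {mpoly K[n]} -> Prop :=
  ideal_gen (fun p => exists i j : 'I_n, e i j /\ p = 'X_i * 'X_j).

(* The vertices 1, ..., n are shifted to 0, ..., n-1, which does not change
   differences.  When n < k the truncated n - k makes every pair an edge, as
   the integer inequality j - i >= n - k does. *)
Definition cycle_power (n k : nat) : rel 'I_n :=
  fun i j =>
    let adj (a b : nat) :=
      ((a < b) && ((b - a <= k) || (n - k <= b - a)))%N in
    adj i j || adj j i.
Arguments cycle_power : clear implicits.

(* The ceiling of the rational number a / b. *)
Definition ceil_frac (a b : nat) : int := Num.ceil (a%:R / b%:R : rat).

(* Main.v *)
(** The depth of S/I(G) is squeezed between two combinatorial quantities.

    Upper bound: let A be a maximal independent set.  In the Koszul complex of S/I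
    on the squares of the variables, the monomial x_A times the basis vector
    indexed by A is a cocycle which is not a coboundary, in degree |A|; but the
    Koszul cohomology vanishes in all degrees smaller than the length of a regular
    sequence contained in the maximal ideal.  The cycle power C_n^k has a maximal
    independent set with ceil(n / (2k+1)) elements.

    Lower bound: if h is regular on S/(J : x) and on S/(J + x), it is regular on
    S/J.  Branching in this way on the vertices of G reduces to the ideals
    generated by the variables outside an independent set B.  To make a single
    sequence work for all branches over any field, take the complete homogeneous
    symmetric polynomials h_1, ..., h_t in all the variables: they are regular
    modulo such an ideal as soon as t <= |B|.  A family of vertices with disjoint
    closed neighbourhoods never shrinks along the branching.  Branching first on k
    consecutive vertices of C_n^k, one gets such families with
    ceil((n - k) / (2k+1)) elements. *)

From HB Require Import structures.
Require Import Defs.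
From mathcomp Require Import ring zify.
From Stdlib Require Import Classical.

Set Implicit Arguments.
Unset Strict Implicit.
Unset Printing Implicit Defensive.

Import Order.TTheory GRing.Theory Num.Theory.
Local Open Scope ring_scope.

(** * Weakly regular sequences modulo an ideal *)

Section WeaklyRegular.
Variable S : comNzRingType.
Implicit Types (J : S -> Prop) (f g x y p : S) (fs gs : seq S).

Definition is_ideal J :=
  [/\ J 0, forall x y, J x -> J y -> J (x + y) & forall c x, J x -> J (c * x)].

Definition adjoin J f : S -> Prop := fun p => exists c, J (p - c * f).

Definition colon J x : S -> Prop := fun p => J (x * p).

Definition nonzerodiv J f := forall g, J (f * g) -> J g.

(** Only the nonzerodivisor half of regularity; [regular_hsyms] supplies properness. *)
Fixpoint wreg J fs : Prop :=
  if fs is f :: fs' then nonzerodiv J f /\ wreg (adjoin J f) fs' else True.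

Fixpoint congr_seq J fs gs : Prop :=
  match fs, gs with
  | [::], [::] => True
  | f :: fs', g :: gs' => J (f - g) /\ congr_seq (adjoin J f) fs' gs'
  | _, _ => False
  end.

Section IdealTheory.
Variable J : S -> Prop.
Hypothesis idJ : is_ideal J.

Lemma ideal0 : J 0. Proof. by case: idJ. Qed.
Lemma idealD x y : J x -> J y -> J (x + y). Proof. by case: idJ => _ + _; apply. Qed.
Lemma idealMl c x : J x -> J (c * x). Proof. by case: idJ => _ _; apply. Qed.
Lemma idealMr c x : J x -> J (x * c). Proof. by rewrite mulrC; apply: idealMl. Qed.
Lemma idealN x : J x -> J (- x). Proof. by rewrite -mulN1r; apply: idealMl. Qed.
Lemma idealB x y : J x -> J y -> J (x - y).
Proof. by move=> Jx /idealN; apply: idealD. Qed.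

Lemma ideal_sum (T : eqType) (r : seq T) (F : T -> S) :
  (forall i, i \in r -> J (F i)) -> J (\sum_(i <- r) F i).
Proof.
move=> JF; rewrite big_seq; apply: (big_ind J) => //.
- exact: ideal0.
- exact: idealD.
Qed.

Lemma ideal_congr x y : J (x - y) -> J y -> J x.
Proof. by move=> Jxy Jy; rewrite -(subrK y x); apply: idealD. Qed.

Lemma sub_adjoin f p : J p -> adjoin J f p.
Proof. by exists 0; rewrite mul0r subr0. Qed.

Lemma mem_adjoin f : adjoin J f f.
Proof. by exists 1; rewrite mul1r subrr; apply: ideal0. Qed.

Lemma adjoin_ideal f : is_ideal (adjoin J f).
Proof.
split=> [|x y [c Jx] [d Jy]|a x [c Jx]].
- exact/sub_adjoin/ideal0.
- by exists (c + d); rewrite (_ : _ - _ = (x - c * f) + (y - d * f));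
    [apply: idealD | ring].
- by exists (a * c); rewrite (_ : _ - _ = a * (x - c * f)); [apply: idealMl | ring].
Qed.

Lemma colon_ideal x : is_ideal (colon J x).
Proof.
rewrite /colon; split=> [|y z Jy Jz|c y Jy].
- by rewrite mulr0; apply: ideal0.
- by rewrite mulrDr; apply: idealD.
- by rewrite mulrCA; apply: idealMl.
Qed.

End IdealTheory.

Lemma adjoin_ext J1 J2 f : (forall p, J1 p <-> J2 p) ->
  forall p, adjoin J1 f p <-> adjoin J2 f p.
Proof. by move=> eqJ p; split=> -[c]; exists c; apply/eqJ. Qed.

Lemma wreg_ext J1 J2 fs : (forall p, J1 p <-> J2 p) -> wreg J1 fs -> wreg J2 fs.
Proof.
elim: fs J1 J2 => //= f fs IH J1 J2 eqJ [reg1 regs]; split.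
- by move=> g /eqJ/reg1/eqJ.
- exact: IH (adjoin_ext f eqJ) regs.
Qed.

Lemma adjoinC J f g p : adjoin (adjoin J f) g p <-> adjoin (adjoin J g) f p.
Proof.
by split=> -[c [d Jp]]; exists d, c; rewrite addrAC.
Qed.

Lemma adjoin_congr J f g p : is_ideal J -> J (f - g) ->
  adjoin J f p <-> adjoin J g p.
Proof.
move=> idJ Jfg; split=> -[c Jp]; exists c.
- rewrite (_ : _ - _ = p - c * f + c * (f - g)); last by ring.
  by apply: (idealD idJ) => //; apply: idealMl.
- rewrite (_ : _ - _ = p - c * g - c * (f - g)); last by ring.
  by apply: (idealB idJ) => //; apply: idealMl.
Qed.

Lemma wreg_congr J fs gs : is_ideal J -> congr_seq J fs gs ->
  wreg J gs -> wreg J fs.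
Proof.
elim: fs gs J => [|f fs IH] [|g gs] //= J idJ [Jfg cfg] [regg regs]; split.
- move=> h Jfh; apply: regg; apply: (ideal_congr idJ) Jfh.
  by rewrite -mulrBl -opprB mulNr; apply/(idealN idJ)/(idealMr idJ).
- apply: (IH gs) => //; first exact: adjoin_ideal.
  by apply: wreg_ext regs => p; apply: iff_sym; apply: adjoin_congr.
Qed.

Lemma congr_seq_map J (T : Type) (F G : T -> S) (r : seq T) : is_ideal J ->
  (forall i, J (F i - G i)) -> congr_seq J [seq F i | i <- r] [seq G i | i <- r].
Proof.
elim: r J => //= i r IH J idJ JFG; split=> //.
by apply: IH => [|j]; [apply: adjoin_ideal | apply: sub_adjoin].
Qed.

(** If x p = q f modulo J, then f q lies in J + (x), so q = b x modulo J, and x (p - b f) lies in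
    J. *)
Lemma colon_adjoin J x f p : is_ideal J -> nonzerodiv (adjoin J x) f ->
  colon (adjoin J f) x p <-> adjoin (colon J x) f p.
Proof.
move=> idJ regf; split=> [[q Jq]|[q Jq]]; last first.
  by exists (x * q); rewrite (_ : _ - _ = x * (p - q * f)) //; ring.
have [b Jb] : adjoin J x q.
  apply: regf; exists p; rewrite (_ : _ - _ = - (x * p - q * f)); last by ring.
  exact: (idealN idJ).
exists b; rewrite /colon.
rewrite (_ : _ * _ = x * p - q * f + f * (q - b * x)); last by ring.
by apply: (idealD idJ) => //; apply: idealMl.
Qed.

(* The depth lemma for 0 -> S/(J : x) -> S/J -> S/(J + x) -> 0, for a sequence
   that is regular on both ends. *)
Lemma wreg_colon_adjoin J x fs : is_ideal J ->
  wreg (colon J x) fs -> wreg (adjoin J x) fs -> wreg J fs.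
Proof.
elim: fs J => //= f fs IH J idJ [reg1 regs1] [reg2 regs2]; split.
- move=> g Jfg; have [b Jb] : adjoin J x g by apply/reg2/sub_adjoin.
  apply: (ideal_congr idJ Jb); rewrite mulrC.
  apply: reg1; rewrite /colon.
  rewrite (_ : _ * _ = f * g - f * (g - b * x)); last by ring.
  by apply: (idealB idJ) => //; apply: idealMl.
- apply: IH; first exact: adjoin_ideal.
  + by apply: wreg_ext regs1 => p; apply: iff_sym; apply: colon_adjoin.
  + by apply: wreg_ext regs2 => p; apply: adjoinC.
Qed.

Lemma ideal_gen_ideal (G : S -> Prop) : is_ideal (ideal_gen G).
Proof.
split=> [|x y [s [Gs ->]] [t [Gt ->]]|c x [s [Gs ->]]].
- by exists [::]; rewrite big_nil.
- exists (s ++ t); rewrite big_cat; split=> // z.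
  by rewrite mem_cat => /orP[/Gs|/Gt].
- exists [seq (c * z.1, z.2) | z <- s]; split=> [z /mapP[w /Gs Gw ->] //|].
  by rewrite big_map mulr_sumr; apply: eq_bigr => z _; rewrite mulrA.
Qed.

Lemma mem_ideal_gen (G : S -> Prop) p : G p -> ideal_gen G p.
Proof.
exists [:: (1, p)]; rewrite big_seq1 mul1r; split=> // x.
by rewrite inE => /eqP ->.
Qed.

Lemma ideal_gen_sub (G J : S -> Prop) p : is_ideal J -> (forall q, G q -> J q) ->
  ideal_gen G p -> J p.
Proof.
move=> idJ GJ [s [Gs ->]]; apply: (ideal_sum idJ) => z /Gs/GJ; exact: idealMl.
Qed.

Lemma ideal_add_nil J p : is_ideal J -> ideal_add J [::] p <-> J p.
Proof.
move=> idJ; split=> [|Jp]; last by apply: mem_ideal_gen; left.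
by apply: ideal_gen_sub => // q [].
Qed.

Lemma ideal_add_cons J f fs p : is_ideal J ->
  ideal_add J (f :: fs) p <-> ideal_add (adjoin J f) fs p.
Proof.
move=> idJ; split.
- apply: ideal_gen_sub => [|q]; first exact: ideal_gen_ideal.
  rewrite inE => -[Jq|/orP[/eqP ->|qfs]]; apply: mem_ideal_gen.
  + by left; apply: sub_adjoin.
  + by left; apply: mem_adjoin.
  + by right.
- have idA := ideal_gen_ideal (fun q => J q \/ q \in f :: fs).
  apply: ideal_gen_sub => // q [[c Jq]|qfs]; last first.
    by apply: mem_ideal_gen; right; rewrite inE qfs orbT.
  rewrite -(subrK (c * f) q); apply: (idealD idA); first by apply: mem_ideal_gen; left.
  by apply: (idealMl idA); apply: mem_ideal_gen; right; rewrite mem_head.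
Qed.

Lemma wregP J fs : is_ideal J ->
  wreg J fs <-> forall i, (i < size fs)%N -> forall g,
    ideal_add J (take i fs) (fs`_i * g) -> ideal_add J (take i fs) g.
Proof.
elim: fs J => [//|f fs IH] J idJ /=.
have {}IH := IH _ (adjoin_ideal idJ f).
split=> [[regf /IH regfs] [_|i ltis] g|reg].
- by rewrite take0 => /(ideal_add_nil _ idJ)/regf/(ideal_add_nil _ idJ).
- by move=> /(ideal_add_cons _ _ _ idJ)/(regfs i ltis)/(ideal_add_cons _ _ _ idJ).
- split=> [g /(ideal_add_nil _ idJ) Jfg|].
    apply/(ideal_add_nil _ idJ); have := reg 0%N isT g.
    by rewrite take0; apply.
  apply/IH => i ltis g /(ideal_add_cons _ _ _ idJ).
  by move/(reg i.+1 ltis)/(ideal_add_cons _ _ _ idJ).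
Qed.

(** * Adjoining a polynomial that is monic in one variable *)

Definition coef_in J (p : {poly S}) := forall i, J p`_i.

Section Monic.
Variable J : S -> Prop.
Hypothesis idJ : is_ideal J.

Lemma coef_inM (p q : {poly S}) : coef_in J p -> coef_in J (q * p).
Proof.
move=> Jp i; rewrite coefM; apply: (ideal_sum idJ) => j _; exact: idealMl.
Qed.

(** As F is monic, the top coefficient of F V is that of V, so it lies in J; removing that term
    lowers the degree of V. *)
Lemma coef_in_monic_mul F V : F \is monic ->
  (forall i, ((size F).-1 <= i)%N -> J (F * V)`_i) -> coef_in J V.
Proof.
move=> monF; have : size F = (size F).-1.+1.
  by rewrite prednK // size_poly_gt0 monic_neq0.
move: (size F).-1 => e szF; move: {2}(size V) (leqnn (size V)) => s.
elim: s V => [|s IH] V.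
  rewrite leqn0 size_poly_eq0 => /eqP -> _ i.
  by rewrite coef0; apply: ideal0.
move=> szV JFV.
have Jtop : J V`_s.
  have := JFV (e + s)%N (leq_addr _ _).
  rewrite coefM (bigD1 (inord e)) //= inordK; last by rewrite ltnS leq_addr.
  rewrite addKn big1 ?addr0 => [|i nei].
    by have /monicP := monF; rewrite lead_coefE szF /= => ->; rewrite mul1r.
  have [ltie|leei] := ltnP i e.
    by rewrite [V`__]nth_default ?mulr0 //; apply: leq_trans szV _; lia.
  rewrite [F`__]nth_default ?mul0r // szF ltn_neqAle leei andbT.
  apply: contraNneq nei => ei; apply/eqP/val_inj.
  by rewrite /= inordK ?ei // ltnS leq_addr.
pose V' := V - V`_s *: 'X^s.
have eqV : V = V' + V`_s *: 'X^s by rewrite subrK.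
have Jmono : coef_in J (V`_s *: 'X^s).
  by move=> i; rewrite coefZ; apply: idealMr.
have JV' : coef_in J V'.
  apply: IH => [|i /JFV].
    apply/leq_sizeP => i lesi; rewrite coefB coefZ coefXn.
    have [->|nesi] := eqVneq i s; first by rewrite mulr1 subrr.
    rewrite mulr0 subr0 nth_default //.
    by apply: leq_trans szV _; rewrite ltn_neqAle eq_sym nesi.
  rewrite {1}eqV mulrDr coefD => JFVi.
  rewrite -(addrK (F * (V`_s *: 'X^s))`_i (F * V')`_i).
  by apply: (idealB idJ) => //; apply: coef_inM.
by move=> i; rewrite eqV coefD; apply: (idealD idJ).
Qed.

(* [phi] expands elements of [S] in powers of the variable [a], and [J] is
   generated by elements that do not involve [a]. *)
Variables (phi : {rmorphism S -> {poly S}}) (a : S).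
Hypothesis phiK : forall p, (phi p).[a] = p.
Hypothesis freeJ : forall p, J p -> coef_in J (phi p).

Lemma nonzerodiv_monic f : phi f \is monic -> nonzerodiv J f.
Proof.
move=> monf g /freeJ; rewrite rmorphM => Jfg.
have Jg : coef_in J (phi g).
  exact: (coef_in_monic_mul monf).
rewrite -(phiK g) horner_coef; apply: (ideal_sum idJ) => i _; exact: (idealMr idJ).
Qed.

(** Write u = Q f + R by division in the chosen variable. Then p u = v f becomes p R = f (v - p Q)
    modulo J, with left side of degree below f: hence v - p Q, then p R, and finally R vanish modulo
    J. *)
Lemma nonzerodiv_adjoin_monic f p : phi f \is monic -> phi p = p%:P ->
  nonzerodiv J p -> nonzerodiv (adjoin J f) p.
Proof.
move=> monf phip regp u [v Jv].
pose Q := Pdiv.CommonRing.rdivp (phi u) (phi f).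
pose R := Pdiv.CommonRing.rmodp (phi u) (phi f).
have szR : (size R < size (phi f))%N.
  by rewrite Pdiv.CommonRing.ltn_rmodpN0 ?monic_neq0.
have eqU : phi u = Q * phi f + R by exact: Pdiv.RingMonic.rdivp_eq.
have JW : coef_in J (p%:P * R - phi f * (phi v - p%:P * Q)).
  have := freeJ Jv; rewrite rmorphB !rmorphM phip eqU.
  by congr coef_in; ring.
have JV : coef_in J (phi v - p%:P * Q).
  apply: (coef_in_monic_mul monf) => i lei.
  have := idealN idJ (JW i); rewrite coefB opprB coefCM.
  rewrite [R`_i]nth_default ?mulr0 ?subr0 //; apply: leq_trans lei.
  by rewrite -ltnS (ltn_predK szR).
have JR : coef_in J R.
  move=> i; apply: regp; rewrite -coefCM.
  rewrite -(subrK (phi f * (phi v - p%:P * Q)) (p%:P * R)) coefD.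
  by apply: (idealD idJ) => //; apply: coef_inM.
exists Q.[a]; rewrite -{1}(phiK u) eqU hornerD hornerM phiK addrAC subrr add0r.
rewrite horner_coef; apply: (ideal_sum idJ) => i _; exact: (idealMr idJ).
Qed.

End Monic.

Lemma coef_in_adjoin (phi : {rmorphism S -> {poly S}}) J f :
  is_ideal J -> (forall p, J p -> coef_in J (phi p)) -> phi f = f%:P ->
  forall p, adjoin J f p -> coef_in (adjoin J f) (phi p).
Proof.
move=> idJ freeJ phif p [c Jp] i; exists (phi c)`_i.
by have := freeJ _ Jp i; rewrite rmorphB rmorphM phif coefB coefMC.
Qed.

Lemma coef_in_ideal (phi : {rmorphism S -> {poly S}}) J :
  is_ideal J -> is_ideal (fun p => coef_in J (phi p)).
Proof.
move=> idJ; split=> [k|x y Jx Jy k|c x Jx].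
- by rewrite rmorph0 coef0; apply: ideal0.
- by rewrite rmorphD coefD; apply: (idealD idJ).
- by rewrite rmorphM; apply: coef_inM.
Qed.

(** Adjoining g before or after f gives the same ideal, so each member of [fs] is treated by
    [nonzerodiv_adjoin_monic] and then absorbed into J. *)
Lemma wreg_adjoin_monic (phi : {rmorphism S -> {poly S}}) (a : S) J f fs :
    is_ideal J -> (forall p, (phi p).[a] = p) ->
    (forall p, J p -> coef_in J (phi p)) -> phi f \is monic ->
    (forall g, g \in fs -> phi g = g%:P) ->
  wreg J fs -> wreg (adjoin J f) fs.
Proof.
move=> + phiK + monf; elim: fs J => //= g fs IH J idJ freeJ freefs [regg regs].
have phig : phi g = g%:P by apply: freefs; rewrite mem_head.
split; first exact: (nonzerodiv_adjoin_monic idJ phiK).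
apply: wreg_ext (adjoinC J g f) _; apply: IH => //.
- exact: adjoin_ideal.
- exact: coef_in_adjoin.
- by move=> h hfs; apply: freefs; rewrite inE hfs orbT.
Qed.

End WeaklyRegular.

(** * Complete homogeneous symmetric polynomials *)

Section CompleteSymmetric.
Variable S : comNzRingType.
Implicit Types (J : S -> Prop) (x : S) (l : seq S).

(** The monomials of degree j are split into those free of x and x times those of degree j - 1. *)
Fixpoint hsym l : nat -> S :=
  if l is x :: l' then
    fix hx j := if j is j'.+1 then hsym l' j'.+1 + x * hx j' else 1
  else fun j => (j == 0%N)%:R.

Lemma hsym0 l : hsym l 0 = 1. Proof. by case: l. Qed.

Lemma hsym_consS x l j : hsym (x :: l) j.+1 = hsym l j.+1 + x * hsym (x :: l) j.
Proof. by []. Qed.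

(** The recursion h_(s+1)(x, l) = h_(s+1)(l) + x h_s(x, l) loses its last term once h_s(x, l) is in
    J; the member just adjoined serves the next degree. *)
Lemma congr_hsym_behead J x l s t : is_ideal J -> J (hsym (x :: l) s) ->
  congr_seq J [seq hsym (x :: l) j | j <- iota s.+1 t]
              [seq hsym l j | j <- iota s.+1 t].
Proof.
elim: t s J => //= t IH s J idJ Jh; split.
- by rewrite -[X in J (X + _ - _)]/(hsym l s.+1) addrAC subrr add0r; apply: idealMl.
- by apply: IH; [apply: adjoin_ideal | apply: mem_adjoin].
Qed.

Lemma hsym_filter J (T : Type) (X : T -> S) (P : pred T) (l : seq T) j :
  is_ideal J -> (forall i, ~~ P i -> J (X i)) ->
  J (hsym [seq X i | i <- l] j - hsym [seq X i | i <- l & P i] j).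
Proof.
move=> idJ JX; elim: l j => [|i l IH] j; first by rewrite subrr; apply: ideal0.
rewrite map_cons; case: j => [|j]; first by rewrite !hsym0 subrr; apply: ideal0.
rewrite [filter _ _]/=; case: ifPn => [Pi|/JX Ji].
  rewrite map_cons; elim: j.+1 => [|{}j IHj].
    by rewrite !hsym0 subrr; apply: ideal0.
  rewrite !hsym_consS opprD addrACA -mulrBr.
  by apply: (idealD idJ) => //; apply: idealMl.
rewrite hsym_consS addrAC; apply: (idealD idJ) => //; exact: idealMr.
Qed.

Lemma hsym_const (phi : {rmorphism S -> {poly S}}) l j :
  {in l, forall x, phi x = x%:P} -> phi (hsym l j) = (hsym l j)%:P.
Proof.
elim: l j => [|x l IH] j phil; first by rewrite rmorph_nat polyCMn.
elim: j => [|j IHj]; first by rewrite !hsym0 rmorph1.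
rewrite hsym_consS rmorphD rmorphM IHj IH => [|y yl]; last first.
  by apply: phil; rewrite inE yl orbT.
by rewrite phil ?mem_head // polyCD polyCM.
Qed.

Lemma hsym_monic (phi : {rmorphism S -> {poly S}}) x l j :
  {in l, forall y, phi y = y%:P} -> phi x = 'X ->
  phi (hsym (x :: l) j) \is monic.
Proof.
move=> phil phix; elim: j => [|j monh]; first by rewrite rmorph1 monic1.
rewrite hsym_consS rmorphD rmorphM phix hsym_const // monicE.
rewrite (mulrC 'X) lead_coefDr ?lead_coefMX // size_mulX ?monic_neq0 //.
by apply: leq_ltn_trans (size_polyC_leq1 _) _; rewrite ltnS size_poly_gt0 monic_neq0.
Qed.

(* Modulo the first member, which is monic in the first variable, the sequence
   becomes the corresponding one in the remaining variables. *)
Lemma wreg_hsym J (T : eqType) (X : T -> S) (phi : T -> {rmorphism S -> {poly S}})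
    (l : seq T) s t :
    is_ideal J ->
    (forall a p, (phi a p).[X a] = p) ->
    (forall a, phi a (X a) = 'X) ->
    (forall a b, b != a -> phi a (X b) = (X b)%:P) ->
    {in l, forall a p, J p -> coef_in J (phi a p)} ->
    uniq l -> (t <= size l)%N ->
  wreg J [seq hsym [seq X i | i <- l] j | j <- iota s.+1 t].
Proof.
move=> idJ phiK phiX phiC; elim: t l s => [//|t IH] [//|a l] s freeJ.
move=> /andP[nal uniql] lets.
have phil : {in [seq X i | i <- l], forall y, phi a y = y%:P}.
  move=> y /mapP[b bl ->]; apply: phiC.
  by apply: contraNneq nal => <-.
have freea : forall p, J p -> coef_in J (phi a p) by apply: freeJ; rewrite mem_head.
have monf : phi a (hsym [seq X i | i <- a :: l] s.+1) \is monic.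
  exact: hsym_monic.
split; first exact: (nonzerodiv_monic idJ (phiK a)).
apply: (@wreg_congr _ _ _ [seq hsym [seq X i | i <- l] j | j <- iota s.+2 t]).
- exact: adjoin_ideal.
- by apply: congr_hsym_behead; [apply: adjoin_ideal | apply: mem_adjoin].
apply: (@wreg_adjoin_monic _ (phi a) (X a)) => //.
- by move=> g /mapP[j _ ->]; apply: hsym_const.
- by apply: IH => // b bl; apply: freeJ; rewrite inE bl orbT.
Qed.

End CompleteSymmetric.

(** * Edge ideals *)

Section MonomialIdeal.
Variables (K : fieldType) (n : nat).
Implicit Types (U : pred 'X_{1..n}) (p : {mpoly K[n]}) (m : 'X_{1..n}).

Definition mono_ideal U : {mpoly K[n]} -> Prop := fun p => all U (msupp p).

Definition upclosed U := forall m1 m2, U m1 -> U (m1 + m2)%MM.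

Lemma mono_idealX U m : mono_ideal U 'X_[m] <-> U m.
Proof. by rewrite /mono_ideal msuppX /= andbT. Qed.

Lemma mono_ideal_ideal U : upclosed U -> is_ideal (mono_ideal U).
Proof.
move=> upU; split=> [|p q /allP Up /allP Uq|c p /allP Up].
- by rewrite /mono_ideal msupp0.
- apply/allP=> m /msuppD_le; rewrite mem_cat => /orP[]; [exact: Up | exact: Uq].
- apply/allP=> m /msuppM_le/allpairsP[[m1 m2] /= [_ m2p ->]].
  by rewrite addmC; apply/upU/Up.
Qed.

Lemma mono_ideal_sub U (J : {mpoly K[n]} -> Prop) p : is_ideal J ->
  (forall m, U m -> J 'X_[m]) -> mono_ideal U p -> J p.
Proof.
move=> idJ UJ /allP Up; rewrite (mpolyE p); apply: (ideal_sum idJ) => m /Up/UJ.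
by rewrite -mul_mpolyC; apply: idealMl.
Qed.

Lemma mnm_factor m i : (0 < m i)%N -> exists m', m = (U_(i) + m')%MM.
Proof.
move=> mi; exists (m - U_(i))%MM; rewrite addmC submK //.
by apply/mnm_lepP=> j; rewrite mnm1E; case: eqP => // <-.
Qed.

(* [p] seen as a polynomial in ['X_a], with ['X_a] replaced by ['X]. *)
Definition isolate (a : 'I_n) : {mpoly K[n]} -> {poly {mpoly K[n]}} :=
  mmap (polyC \o mpolyC n (R := K)) (fun i => if i == a then 'X else ('X_i)%:P).

HB.instance Definition _ a := GRing.RMorphism.on (isolate a).

Lemma isolate_var a : isolate a 'X_a = 'X.
Proof. by rewrite /isolate mmapX mmap1U eqxx. Qed.

Lemma isolate_neq a b : b != a -> isolate a 'X_b = ('X_b)%:P.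
Proof. by rewrite /isolate mmapX mmap1U => /negPf ->. Qed.

Lemma isolateK a p : (isolate a p).['X_a] = p.
Proof.
rewrite [in RHS](mpolyE p) /isolate /mmap horner_sum; apply: eq_bigr => m _.
rewrite hornerM hornerC mul_mpolyC [in RHS]mpolyXE_id; congr (_ *: _).
rewrite /mmap1 horner_prod; apply: eq_bigr => i _; rewrite horner_exp.
by case: eqP => [->|_]; rewrite ?hornerX ?hornerC.
Qed.

End MonomialIdeal.

(** * Branching on a vertex, and regular sequences from packings *)

Section Branching.
Variables (K : fieldType) (n : nat) (e : rel 'I_n).
Hypotheses (sym_e : forall i j, e i j = e j i) (irr_e : irreflexive e).
Implicit Types (D C : {set 'I_n}) (m : 'X_{1..n}) (p : {mpoly K[n]}).

Definition edge_or_in D m :=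
  [exists i, (0 < m i)%N && ((i \in D) || [exists j, e i j && (0 < m j)%N])].

Lemma edge_or_inP D m :
  reflect (exists2 i, (0 < m i)%N & i \in D \/ exists2 j, e i j & (0 < m j)%N)
          (edge_or_in D m).
Proof.
apply: (iffP existsP) => -[i]; last first.
  move=> mi iD; exists i; rewrite mi; case: iD => [-> //|[j eij mj]].
  by apply/orP; right; apply/existsP; exists j; rewrite eij.
case/andP=> mi /orP[iD|/existsP[j /andP[eij mj]]]; exists i => //.
  by left.
by right; exists j.
Qed.

(* The ideal (x_i : i in D) + I(e), described by the monomials it contains. *)
Definition edge_var_ideal D := mono_ideal (K := K) (edge_or_in D).

Lemma edge_or_in_up D : upclosed (edge_or_in D).
Proof.
move=> m1 m2 /edge_or_inP[i mi iD]; apply/edge_or_inP; exists i.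
  by rewrite mnmDE addn_gt0 mi.
case: iD => [|[j eij mj]]; [by left | right; exists j => //].
by rewrite mnmDE addn_gt0 mj.
Qed.

Lemma edge_var_ideal_ideal D : is_ideal (edge_var_ideal D).
Proof. exact/mono_ideal_ideal/edge_or_in_up. Qed.

Lemma edge_idealE p : edge_ideal e p <-> edge_var_ideal set0 p.
Proof.
split.
- apply: ideal_gen_sub => [|q [i [j [eij ->]]]]; first exact: edge_var_ideal_ideal.
  rewrite -mpolyXD; apply/mono_idealX/edge_or_inP; exists i.
    by rewrite mnmDE mnm1E eqxx.
  by right; exists j; rewrite // mnmDE !mnm1E eqxx addn1.
- apply: mono_ideal_sub => [|m /edge_or_inP[i mi]]; first exact: ideal_gen_ideal.
  rewrite inE => -[//|[j eij mj]].
  (* Irreflexivity makes j different from i, so x_j still divides the monomial once x_i is taken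
     out. *)
  have [m1 eqm] := mnm_factor mi; have mj1 : (0 < m1 j)%N.
    by move: mj eij; rewrite eqm mnmDE mnm1E; case: eqP => // <-; rewrite irr_e.
  rewrite eqm.
  have [m2 ->] := mnm_factor mj1; rewrite addmA mpolyXD mulrC mpolyXD.
  apply: idealMl; first exact: ideal_gen_ideal.
  by apply: mem_ideal_gen; exists i, j.
Qed.

Lemma edge_var_ideal_var D i : i \in D -> edge_var_ideal D 'X_i.
Proof.
move=> iD; apply/mono_idealX/edge_or_inP; exists i; last by left.
by rewrite mnm1E eqxx.
Qed.

Definition nbhd v := [set u | e v u].

(** If x_v m lies in the ideal, either m already does, or the witness is an edge from v to some j
    with x_j dividing m; the neighbours of v account for the second case. *)
Lemma colon_edge_var_ideal D v p : v \notin D ->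
  colon (edge_var_ideal D) 'X_v p <-> edge_var_ideal (D :|: nbhd v) p.
Proof.
move=> vD; have idD := edge_var_ideal_ideal D.
split; last first.
  apply: mono_ideal_sub; first exact: colon_ideal.
  move=> m /edge_or_inP[i mi]; rewrite !inE /colon -mpolyXD => iD.
  apply/mono_idealX/edge_or_inP.
  case: iD => [/orP[iD|evi]|[j eij mj]].
  - by exists i; [rewrite mnmDE addn_gt0 mi orbT | left].
  - exists v; first by rewrite mnmDE mnm1E eqxx.
    by right; exists i; rewrite // mnmDE addn_gt0 mi orbT.
  - exists i; first by rewrite mnmDE addn_gt0 mi orbT.
    by right; exists j; rewrite // mnmDE addn_gt0 mj orbT.
move=> /allP Dvp; apply/allP => m mp; have := Dvp (U_(v) + m)%MM.
rewrite mulrC (perm_mem (msuppMX _ _)) map_f // => /(_ isT)/edge_or_inP[i].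
rewrite mnmDE mnm1E => mi iD; apply/edge_or_inP.
have [eqvi|neqvi] := eqVneq v i; last first.
  move: mi; rewrite (negPf neqvi) add0n => mi.
  exists i => //; rewrite !inE; case: iD => [->|[j eij]]; first by left.
  rewrite mnmDE mnm1E; case: eqP => [->|_]; last by right; exists j.
  by rewrite sym_e eij orbT; left.
rewrite -{i}eqvi in mi iD; case: iD => [vD'|[j evj]]; first by rewrite vD' in vD.
rewrite mnmDE mnm1E; case: eqP evj => [->|_ evj mj]; first by rewrite irr_e.
by exists j; rewrite // !inE evj orbT; left.
Qed.

Lemma adjoin_edge_var_ideal D v p :
  adjoin (edge_var_ideal D) 'X_v p <-> edge_var_ideal (v |: D) p.
Proof.
have idD := edge_var_ideal_ideal D; have idv := edge_var_ideal_ideal (v |: D).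
split.
- case=> c Dp; apply: (ideal_congr idv (y := c * 'X_v)); last first.
    by apply: (idealMl idv); apply: edge_var_ideal_var; rewrite setU11.
  apply: sub_all Dp => m /edge_or_inP[i mi iD]; apply/edge_or_inP; exists i => //.
  by case: iD => [iD|[j eij mj]]; [left; rewrite inE iD orbT | right; exists j].
- apply: mono_ideal_sub => [|m /edge_or_inP[i mi]]; first exact: adjoin_ideal.
  have [m1 ->] := mnm_factor mi; rewrite !inE => -[/orP[/eqP ->|iD]|[j eij mj]].
  + by rewrite mpolyXD mulrC; apply: idealMl; [exact: adjoin_ideal | exact: mem_adjoin].
  + apply: sub_adjoin; rewrite mpolyXD mulrC; apply: (idealMl idD).
    exact: edge_var_ideal_var.
  + apply: sub_adjoin; apply/mono_idealX/edge_or_inP.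
    by exists i; [rewrite mnmDE mnm1E eqxx | right; exists j].
Qed.

Definition hsyms t : seq {mpoly K[n]} :=
  [seq hsym [seq 'X_i | i <- enum 'I_n] j | j <- iota 1 t].

(** With no edge outside [D], each monomial of the ideal is divisible by a variable of [D], which is
    not x_a. *)
Lemma coef_in_edge_var_ideal D a p :
    (forall i j, i \notin D -> j \notin D -> ~~ e i j) -> a \notin D ->
  edge_var_ideal D p -> coef_in (edge_var_ideal D) (isolate a p).
Proof.
move=> indD aD; have idD := edge_var_ideal_ideal D.
have idc := coef_in_ideal (isolate a) idD.
apply: (mono_ideal_sub idc) => m /edge_or_inP[i mi iD].
have {iD} [j jD /mnm_factor[m1 ->]] : exists2 j, j \in D & (0 < m j)%N.
  case: iD => [iD|[j eij mj]]; first by exists i.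
  have [|iD] := boolP (i \in D); first by exists i.
  have [|jD] := boolP (j \in D); first by exists j.
  by have := indD _ _ iD jD; rewrite eij.
have Xj : coef_in (edge_var_ideal D) (isolate a 'X_j).
  move=> k; rewrite isolate_neq; last by apply: contraNneq aD => <-.
  rewrite coefC; case: eqP => _; last exact: ideal0.
  exact: edge_var_ideal_var.
by rewrite mpolyXD mulrC; apply: (idealMl idc) Xj.
Qed.

Lemma wreg_hsyms_indep D t : (forall i j, i \notin D -> j \notin D -> ~~ e i j) ->
  (t <= #|~: D|)%N -> wreg (edge_var_ideal D) (hsyms t).
Proof.
move=> indD lets; have idD := edge_var_ideal_ideal D.
pose l := [seq i <- enum 'I_n | i \in ~: D].
apply: (@wreg_congr _ _ _ [seq hsym [seq 'X_i | i <- l] j | j <- iota 1 t]) => //.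
  apply: congr_seq_map => // j; apply: hsym_filter => // i.
  by rewrite inE negbK; apply: edge_var_ideal_var.
have freel : {in l, forall a p, edge_var_ideal D p ->
    coef_in (edge_var_ideal D) (isolate a p)}.
  move=> a; rewrite mem_filter !inE => /andP[aD _] p.
  exact: coef_in_edge_var_ideal.
have uniql : uniq l by rewrite filter_uniq ?enum_uniq.
have szl : (t <= size l)%N.
  by rewrite (leq_trans lets) // cardE /l enumT.
by apply: (wreg_hsym 0 idD (@isolateK K n) (@isolate_var K n) _ freel uniql szl)
  => a b; apply: isolate_neq.
Qed.

(* Closed neighbourhoods are taken in the graph induced on the complement of [D]. *)
Definition packing D C : Prop :=
  [/\ {in C, forall c, c \notin D} & forall u c1 c2, u \notin D ->
     c1 \in C -> c2 \in C -> (u == c1) || e u c1 -> (u == c2) || e u c2 ->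
     c1 = c2].

Lemma packing_delete D C v : v \notin C -> packing D C -> packing (v |: D) C.
Proof.
move=> vC [CD packC]; split=> [c cC|u c1 c2].
  by rewrite !inE negb_or CD // andbT; apply: contraNneq vC => <-.
by rewrite !inE negb_or => /andP[_ uD]; apply: packC.
Qed.

(** The vertex v replaces the members of [C] adjacent to it. There is at most one, since v lies in
    the closed neighbourhood of each; and with its neighbours in [D], v is alone in its closed
    neighbourhood. *)
Lemma packing_nbhd D C v : v \notin D -> v \notin C -> packing D C ->
  packing (D :|: nbhd v) (v |: C :\: nbhd v) /\
  (#|C| <= #|v |: C :\: nbhd v|)%N.
Proof.
move=> vD vC [CD packC]; split.
  split=> [c|u c1 c2].
    rewrite !inE negb_or => /orP[/eqP ->|/andP[nevc cC]]; first by rewrite vD irr_e.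
    by rewrite CD.
  rewrite !inE negb_or => /andP[uD nevu].
  move=> /orP[/eqP ->|/andP[nevc1 c1C]] /orP[/eqP ->|/andP[nevc2 c2C]] //.
  - rewrite (sym_e u) (negPf nevu) orbF => /eqP equv.
    by rewrite equv (negPf nevc2) orbF => /eqP vc2; rewrite vc2 c2C in vC.
  - move=> uc1; rewrite (sym_e u v) (negPf nevu) orbF => /eqP equv.
    by move: uc1; rewrite equv (negPf nevc1) orbF => /eqP vc1; rewrite vc1 c1C in vC.
  - exact: packC.
have le1 : (#|C :&: nbhd v| <= 1)%N.
  apply/card_le1_eqP => c1 c2; rewrite !inE => /andP[c1C ev1] /andP[c2C ev2].
  by apply: (packC v) => //; rewrite ?ev1 ?ev2 orbT.
rewrite cardsU1 !inE (negPf vC) andbF /= -(cardsID (nbhd v) C).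
by rewrite leq_add2r.
Qed.

(** Induction on the number of vertices outside [D]. While an edge remains there, branch on an
    endpoint outside [C]; both branches keep a packing at least as large. Without edges, [C] is part
    of the independent complement of [D]. *)
Lemma wreg_packing D C t : packing D C -> (t <= #|C|)%N ->
  wreg (edge_var_ideal D) (hsyms t).
Proof.
have [s] := ubnP #|~: D|; elim: s D C => // s IH D C ltDs packDC letC.
have [CD packC] := packDC.
have [/existsP[u /existsP[v /and3P[uD vD euv]]]|noedge] :=
    boolP [exists u, exists v, [&& u \notin D, v \notin D & e u v]]; last first.
  apply: wreg_hsyms_indep => [i j iD jD|].
    apply: contra noedge => eij; apply/existsP; exists i; apply/existsP; exists j.
    by rewrite iD jD.
  apply: leq_trans letC _; apply/subset_leq_card/subsetP => c cC.
  by rewrite inE CD.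
wlog vC : u v uD vD euv / v \notin C => [hwlog|].
  have [vC|] := boolP (v \in C); last exact: (hwlog u v).
  apply: (hwlog v u) => //; first by rewrite sym_e.
  apply: contraTN (euv) => uC.
  have -> : u = v by apply: (packC u) => //; rewrite ?eqxx ?euv ?orbT.
  by rewrite irr_e.
have ltD w (E : {set _}) : w \notin D -> w \in E -> (#|~: (E :|: D)| < s)%N.
  move=> wD wE; rewrite -ltnS; apply: leq_trans ltDs.
  rewrite ltnS; apply: proper_card; apply/properP; split.
    by rewrite setCS subsetUr.
  by exists w; rewrite !inE ?wE.
apply: wreg_colon_adjoin; first exact: edge_var_ideal_ideal.
- have [packv leC] := packing_nbhd vD vC packDC.
  apply: wreg_ext (fun p => iff_sym (colon_edge_var_ideal p vD)) _.
  apply: (IH _ _ _ packv); last exact: leq_trans letC leC.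
  by rewrite setUC; apply: (ltD u); rewrite // inE sym_e.
- apply: wreg_ext (fun p => iff_sym (adjoin_edge_var_ideal D v p)) _.
  apply: (IH _ _ _ (packing_delete vC packDC)) => //.
  by apply: (ltD v); rewrite // inE.
Qed.

End Branching.

(** * Koszul cohomology *)

Section Koszul.
Variables (S : comNzRingType) (I : eqType) (y : I -> S).
Implicit Types (J : S -> Prop) (f : S) (r : seq I).

(* The Koszul complex of [i :: r] is the mapping cone of multiplication by
   [y i] on that of [r]. *)
Fixpoint koszul r : lmodType S :=
  if r is _ :: r' then (koszul r' * koszul r')%type else S^o.

(** The second component of a pair is the coefficient of the basis vector e_i; the differential is
    the wedge product with the sum of the y_i e_i, whence the sign. *)
Fixpoint kdiff r : koszul r -> koszul r :=
  if r is i :: r' then fun z => (kdiff z.1, y i *: z.1 - kdiff z.2) else fun=> 0.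

(* Contraction with the dual of the basis vector of index [i]. *)
Fixpoint kcontr (i : I) r : koszul r -> koszul r :=
  if r is j :: r' then fun z =>
    if j == i then (z.2, 0) else (kcontr i z.1, - kcontr i z.2)
  else fun=> 0.

(** Stands for vanishing in the Koszul complex of S/J; the cochains themselves stay over S. *)
Fixpoint kin J r : koszul r -> Prop :=
  if r is _ :: r' then fun z => kin J z.1 /\ kin J z.2 else J.

(* [z] is homogeneous of degree [d - 1]: the shift makes 0 the only element of
   degree [0 - 1]. *)
Fixpoint kdeg (d : nat) r : koszul r -> Prop :=
  if r is _ :: r' then fun z => kdeg d z.1 /\ kdeg d.-1 z.2
  else fun z => d = 1%N \/ z = 0.

Lemma kdiffD r : {morph @kdiff r : z w / z + w}.
Proof.
elim: r => [|i r IH] z w /=; first by rewrite addr0.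
by rewrite !IH scalerDr opprD addrACA.
Qed.

Lemma kdiffZ r c : {morph @kdiff r : z / c *: z}.
Proof.
elim: r => [|i r IH] z /=; first by rewrite scaler0.
rewrite !IH; congr (_, _).
by rewrite scalerBr !scalerA mulrC.
Qed.

Lemma kdiff0 r : @kdiff r 0 = 0.
Proof. by rewrite -[in LHS](scale0r 0) kdiffZ scale0r. Qed.

Lemma kdiffN r : {morph @kdiff r : z / - z}.
Proof. by move=> z; rewrite -scaleN1r kdiffZ scaleN1r. Qed.

Lemma kdiffB r : {morph @kdiff r : z w / z - w}.
Proof. by move=> z w; rewrite kdiffD kdiffN. Qed.

Lemma kdiffK r z : @kdiff r (kdiff z) = 0.
Proof.
elim: r z => [|i r IH] z //=.
by rewrite IH kdiffB IH subr0 kdiffZ subrr.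
Qed.

Lemma kcontrD i r : {morph @kcontr i r : z w / z + w}.
Proof.
elim: r => [|j r IH] z w /=; first by rewrite addr0.
by case: eqP => _ /=; [congr (_, _); rewrite addr0 | rewrite !IH opprD].
Qed.

Lemma kcontrZ i r c : {morph @kcontr i r : z / c *: z}.
Proof.
elim: r => [|j r IH] z /=; first by rewrite scaler0.
by case: eqP => _; congr (_, _); rewrite ?IH ?scalerN ?scaler0.
Qed.

Lemma kcontrN i r : {morph @kcontr i r : z / - z}.
Proof. by move=> z; rewrite -scaleN1r kcontrZ scaleN1r. Qed.

(** Makes contraction a null homotopy of multiplication by y_i, so that the y_i annihilate the
    cohomology. *)
Lemma kcontr_homotopy i r (z : koszul r) : i \in r ->
  kdiff (kcontr i z) + kcontr i (kdiff z) = y i *: z.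
Proof.
elim: r z => // j r IH [z w]; rewrite inE /= eq_sym.
case: eqP => [<- _|_ /= ir]; congr (_, _) => /=.
- by rewrite addrC subrK.
- by rewrite kdiff0 subr0 addr0.
- exact: IH.
- rewrite kdiffN opprK kcontrD kcontrN kcontrZ opprB addrC addrA subrK addrC.
  exact: IH.
Qed.

Lemma kin0 J r : is_ideal J -> @kin J r 0.
Proof. by move=> idJ; elim: r => //=; apply: ideal0. Qed.

Lemma kinD J r z w : is_ideal J -> kin J z -> kin J w -> @kin J r (z + w).
Proof.
move=> idJ; elim: r z w => [|i r IH] z w /=; first exact: idealD.
by move=> [? ?] [? ?]; split; apply: IH.
Qed.

Lemma kinZ J r c z : is_ideal J -> kin J z -> @kin J r (c *: z).
Proof.
move=> idJ; elim: r z => [|i r IH] z /=; first exact: idealMl.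
by move=> [? ?]; split; apply: IH.
Qed.

Lemma kinN J r z : is_ideal J -> kin J z -> @kin J r (- z).
Proof. by move=> idJ; rewrite -scaleN1r; apply: kinZ. Qed.

Lemma kinB J r z w : is_ideal J -> kin J z -> kin J w -> @kin J r (z - w).
Proof. by move=> idJ Jz Jw; apply/kinD/kinN. Qed.

Lemma kin_sub J1 J2 r z : (forall p, J1 p -> J2 p) -> kin J1 z -> @kin J2 r z.
Proof.
by move=> sJ; elim: r z => //= i r IH z [/IH ? /IH ?].
Qed.

Lemma kin_kdiff J r z : is_ideal J -> kin J z -> @kin J r (kdiff z).
Proof.
move=> idJ; elim: r z => [|i r IH] z /=; first by move=> _; apply: ideal0.
by move=> [/[dup] /IH ? Jz1 /IH ?]; split=> //; apply: kinB => //; apply: kinZ.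
Qed.

Lemma kin_kcontr J i r z : is_ideal J -> kin J z -> @kin J r (kcontr i z).
Proof.
move=> idJ; elim: r z => [|j r IH] z /=; first by move=> _; apply: ideal0.
move=> [Jz1 Jz2]; case: eqP => _ /=; first by split=> //; apply: kin0.
by split; [apply: IH | apply/kinN/IH].
Qed.

Lemma kin_nonzerodiv J f r z : nonzerodiv J f -> kin J (f *: z) -> @kin J r z.
Proof.
move=> regf; elim: r z => [|i r IH] z /=; first exact: regf.
by move=> [/IH ? /IH ?].
Qed.

Lemma kdeg_zero r z : @kdeg 0 r z -> z = 0.
Proof.
elim: r z => [|i r IH] z /=; first by case.
by case: z => z w [/IH /= -> /IH /= ->].
Qed.

Lemma kdeg0 d r : @kdeg d r 0.
Proof. by elim: r d => [|i r IH] d /=; [right | split]. Qed.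

Lemma kdegD d r z w : kdeg d z -> kdeg d w -> @kdeg d r (z + w).
Proof.
elim: r d z w => [|i r IH] d z w /=.
  by move=> [|->]; [left | rewrite add0r].
by move=> [? ?] [? ?]; split; apply: IH.
Qed.

Lemma kdegZ d r c z : kdeg d z -> @kdeg d r (c *: z).
Proof.
elim: r d z => [|i r IH] d z /=.
  by move=> [|->]; [left | right; rewrite scaler0].
by move=> [? ?]; split; apply: IH.
Qed.

Lemma kdegN d r z : kdeg d z -> @kdeg d r (- z).
Proof. by rewrite -scaleN1r; apply: kdegZ. Qed.

Lemma kdegB d r z w : kdeg d z -> kdeg d w -> @kdeg d r (z - w).
Proof. by move=> ? ?; apply/kdegD/kdegN. Qed.

Lemma kdeg_kdiff d r z : kdeg d.-1 z -> @kdeg d r (kdiff z).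
Proof.
elim: r d z => [|i r IH] d z /=; first by right.
move=> [/[dup] z1 /IH dz1 /IH dz2]; split=> //.
case: d z1 dz2 {dz1} => [|d] z1 dz2; apply: kdegB => //; exact: kdegZ.
Qed.

Lemma kdeg_kcontr d i r z : kdeg d z -> @kdeg d.-1 r (kcontr i z).
Proof.
elim: r d z => [|j r IH] d z /=; first by right.
move=> [z1 z2]; case: eqP => _ /=; first by split=> //; apply: kdeg0.
by split; [apply: IH | apply/kdegN/IH].
Qed.

Lemma kin_adjoinZ J f r (z : koszul r) : is_ideal J -> kin (adjoin J f) (f *: z).
Proof.
move=> idJ; elim: r z => [|i r IH] z /=; last by split; apply: IH.
by exists z; rewrite mulrC subrr; apply: ideal0.
Qed.

Lemma kin_adjoin J f d r (z : koszul r) : is_ideal J -> kdeg d z ->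
  kin (adjoin J f) z -> exists2 v, kdeg d v & kin J (z - f *: v).
Proof.
move=> idJ; elim: r d z => [|i r IH] d /=.
  move=> z [->|->] [c Jz].
    by exists c; [left | move: Jz; rewrite mulrC].
  by exists 0; [right | rewrite scaler0 subrr; apply: ideal0].
move=> [z w] /= [degz degw] [/(IH _ _ degz)[v1 degv1 Jv1] /(IH _ _ degw)[v2 degv2 Jv2]].
by exists (v1, v2).
Qed.

(* The cochain [z] of degree [d - 1] is a coboundary modulo [J]. *)
Definition kexact J r d (z : koszul r) :=
  exists2 w, kdeg d.-1 w & kin J (z - kdiff w).

Lemma kexactD J r d z w : is_ideal J ->
  kexact J d z -> kexact J d w -> @kexact J r d (z + w).
Proof.
move=> idJ [u degu Ju] [v degv Jv]; exists (u + v); first exact: kdegD.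
by rewrite kdiffD opprD addrACA; apply: kinD.
Qed.

Lemma kexactZ J r d c z : is_ideal J -> kexact J d z -> @kexact J r d (c *: z).
Proof.
move=> idJ [u degu Ju]; exists (c *: u); first exact: kdegZ.
by rewrite kdiffZ -scalerBr; apply: kinZ.
Qed.

Lemma kexact_var J r d i (z : koszul r) : is_ideal J -> i \in r ->
  kdeg d z -> kin J (kdiff z) -> kexact J d (y i *: z).
Proof.
move=> idJ ir degz Jdz; exists (kcontr i z); first exact: kdeg_kcontr.
by rewrite -kcontr_homotopy // addrC addKr; apply: kin_kcontr.
Qed.

Lemma kexact_ideal J r d f (z : koszul r) : is_ideal J ->
  ideal_gen (fun p => exists2 i, i \in r & p = y i) f ->
  kdeg d z -> kin J (kdiff z) -> kexact J d (f *: z).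
Proof.
move=> idJ [s [sy ->]] degz Jdz; rewrite scaler_suml big_seq.
apply: (big_ind (kexact J d)) => [|u v|x /sy[i ir ->]].
- by exists 0; [exact: kdeg0 | rewrite kdiff0 subrr; apply: kin0].
- exact: kexactD.
- by rewrite -scalerA; apply: kexactZ => //; apply: kexact_var.
Qed.

(* The connecting homomorphism of 0 -> S/J -> S/J -> S/(J + f) -> 0 vanishes, so
   multiplication by [f] is injective on cohomology; a power of it is zero. *)
Lemma wreg_kexact J r fs d (z : koszul r) : is_ideal J ->
    {in fs, forall f, exists N,
      ideal_gen (fun p => exists2 i, i \in r & p = y i) (f ^+ N)} ->
    wreg J fs -> (d <= size fs)%N ->
  kdeg d z -> kin J (kdiff z) -> kexact J d z.
Proof.
elim: fs J d z => [|f fs IH] J d z idJ nilfs.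
  rewrite leqn0 => _ /eqP -> /kdeg_zero -> _; exists 0; first exact: kdeg0.
  by rewrite kdiff0 subrr; apply: kin0.
move=> /= [regf regfs] led degz Jdz.
have [N fN] : exists N, ideal_gen (fun p => exists2 i, i \in r & p = y i) (f ^+ N).
  by apply: nilfs; rewrite mem_head.
have := kexact_ideal idJ fN degz Jdz.
elim: N {fN} => [|N IHN]; first by rewrite expr0 scale1r.
rewrite exprS -scalerA; move: (f ^+ N *: z) (kdegZ (f ^+ N) degz) IHN.
move=> u degu IHN [w degw Jw]; apply: IHN.
have idJf := adjoin_ideal idJ f.
(* From f u = d w modulo J, w is a cocycle modulo J + (f), one degree lower; by induction w = d v +
   f t modulo J, and then f (u - d t) has its coefficients in J. *)
have Jdw : kin (adjoin J f) (kdiff w).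
  rewrite -[kdiff w](subKr (f *: u)); apply: (kinB idJf); first exact: kin_adjoinZ.
  by apply: kin_sub Jw => p; apply: sub_adjoin.
have [||v degv Jv] := IH _ _ _ idJf _ regfs _ degw Jdw.
- by move=> g gfs; apply: nilfs; rewrite inE gfs orbT.
- by case: (d) led.
have [t degt Jt] := kin_adjoin idJ (kdegB degw (kdeg_kdiff degv)) Jv.
exists t => //; apply: (kin_nonzerodiv regf).
rewrite (_ : _ *: _ = (f *: u - kdiff w) + kdiff (w - kdiff v - f *: t)).
  by apply: kinD => //; apply: kin_kdiff.
by rewrite !kdiffB kdiffK subr0 kdiffZ addrA subrK scalerBr.
Qed.

End Koszul.

(** * Coefficients at one basis vector of the Koszul complex *)

Section KoszulBasis.
Variables (S : comNzRingType) (I : eqType) (y : I -> S) (P : pred I).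
Implicit Types (J : S -> Prop) (u : S) (r : seq I).

(* [u] times the basis vector indexed by the elements of [r] satisfying [P]. *)
Fixpoint kbasis u r : koszul S r :=
  if r is i :: r' then if P i then (0, kbasis u r') else (kbasis u r', 0) else u.

Fixpoint kcoef r : koszul S r -> S :=
  if r is i :: r' then fun z => if P i then kcoef z.2 else kcoef z.1 else id.

Lemma kcoef_kbasis u r : kcoef (kbasis u r) = u.
Proof. by elim: r => //= i r IH; case: (P i). Qed.

Lemma kcoefB r : {morph @kcoef r : z w / z - w}.
Proof. by elim: r => //= i r IH z w; case: (P i); rewrite IH. Qed.

Lemma kcoefZ r c z : kcoef (c *: z) = c * @kcoef r z.
Proof. by elim: r z => //= i r IH z; case: (P i); rewrite IH. Qed.

Lemma kin_kcoef J r z : kin J z -> J (@kcoef r z).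
Proof. by elim: r z => //= i r IH z [? ?]; case: (P i); apply: IH. Qed.

Lemma kdeg_kbasis u r : kdeg (count P r).+1 (kbasis u r).
Proof.
elim: r => [|i r IH] /=; first by left.
by case: (P i); split=> //; apply: kdeg0.
Qed.

Lemma kinZ_kbasis J c u r : is_ideal J -> J (c * u) -> kin J (c *: kbasis u r).
Proof.
move=> idJ Jcu; elim: r => //= i r IH.
by case: (P i); split=> //=; rewrite scaler0; apply: kin0.
Qed.

(** The differential of u e_P is a signed sum of the y_i u e_(P + i) over i outside [P]. *)
Lemma kin_kdiff_kbasis J u r : is_ideal J -> (forall i, ~~ P i -> J (y i * u)) ->
  kin J (kdiff y (kbasis u r)).
Proof.
move=> idJ Jyu; elim: r => [|i r IH] /=; first exact: ideal0.
case: ifPn => [_|/Jyu Ju] /=; rewrite kdiff0.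
  by split; [apply: kin0 | rewrite scaler0 sub0r; apply: kinN].
by split=> //; rewrite subr0; apply: kinZ_kbasis.
Qed.

Lemma kcoef_kdiff J r z : is_ideal J -> (forall i, P i -> J (y i)) ->
  J (@kcoef r (kdiff y z)).
Proof.
move=> idJ Jy; elim: r z => [|i r IH] z /=; first exact: ideal0.
case: ifP => [/Jy Ji|_]; last exact: IH.
by rewrite kcoefB kcoefZ; apply: (idealB idJ) => //; apply: idealMr.
Qed.

(** The coefficient at e_P of a coboundary is a combination of the y_i with i in [P], so it lies in
    J', and u agrees with it modulo J. *)
Lemma kexact_kbasis J J' u r d : is_ideal J' -> (forall p, J p -> J' p) ->
  (forall i, P i -> J' (y i)) -> kexact y J d (kbasis u r) -> J' u.
Proof.
move=> idJ' sJ Jy [w _ /kin_kcoef/sJ]; rewrite kcoefB kcoef_kbasis => Ju.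
by apply: (ideal_congr idJ' Ju); apply: kcoef_kdiff.
Qed.

End KoszulBasis.

Lemma radical_ideal (S : comNzRingType) (J : S -> Prop) :
  is_ideal J -> is_ideal (fun f => exists N, J (f ^+ N)).
Proof.
move=> idJ; split=> [|f g [N JfN] [M JgM]|c f [N JfN]].
- by exists 1%N; apply: ideal0.
- exists (N + M)%N; rewrite exprDn -(big_mkord xpredT
    (fun i => f ^+ (N + M - i) * g ^+ i *+ 'C(N + M, i))).
  apply: (ideal_sum idJ) => i _; rewrite -mulr_natl; apply: (idealMl idJ).
  have [leMi|ltiM] := leqP M i.
    by rewrite -(subnK leMi) exprD; apply/(idealMl idJ)/(idealMl idJ).
  rewrite (_ : N + M - i = (M - i) + N)%N; last by lia.
  by rewrite exprD; apply/(idealMr idJ)/(idealMl idJ).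
- by exists N; rewrite exprMn; apply: idealMl.
Qed.

(** * Depth bounds for edge ideals *)

Section DepthBounds.
Variables (K : fieldType) (n : nat) (e : rel 'I_n).
Hypotheses (sym_e : forall i j, e i j = e j i) (irr_e : irreflexive e).
Implicit Types (p f : {mpoly K[n]}) (fs : seq {mpoly K[n]}) (A : {set 'I_n}).

Lemma edge_ideal_ideal : is_ideal (edge_ideal (K := K) e).
Proof. exact: ideal_gen_ideal. Qed.

Lemma graded_maxideal_nilp f : graded_maxideal f ->
  exists N, ideal_gen (fun p => exists2 i : 'I_n, i \in enum 'I_n & p = 'X_i ^+ 2)
              (f ^+ N).
Proof.
apply: (ideal_gen_sub (radical_ideal (ideal_gen_ideal _))) => q [i ->].
by exists 2%N; apply: mem_ideal_gen; exists i; rewrite ?mem_enum.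
Qed.

(* The Koszul class of x_A on the squares of the variables, which survives because
   no edge monomial and no square divides x_A. *)
Lemma regular_seq_leq_dominating A fs :
    {in A &, forall i j, ~~ e i j} ->
    (forall i, i \notin A -> exists2 j, j \in A & e i j) ->
    (forall f, f \in fs -> graded_maxideal f) ->
    regular_seq_quot (edge_ideal e) fs ->
  (size fs <= #|A|)%N.
Proof.
move=> indA domA mfs [/(wregP _ edge_ideal_ideal) regfs _].
rewrite leqNgt; apply/negP => ltA.
pose mA : 'X_{1..n} := [multinom (i \in A : nat) | i < n].
pose U (m : 'X_{1..n}) := edge_or_in e set0 m || [exists i, (1 < m i)%N].
have upU : upclosed U.
  move=> m1 m2 /orP[/(edge_or_in_up m2) m1U|/existsP[i mi]]; apply/orP; first by left.
  by right; apply/existsP; exists i; rewrite mnmDE ltn_addr.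
pose y (i : 'I_n) : {mpoly K[n]} := 'X_i ^+ 2.
have eqA : #|A| = count (mem A) (enum 'I_n) by rewrite -size_filter enumT cardE.
(* [kdeg] is shifted by one, so [#|A|.+1] is cohomological degree |A|, where a regular sequence
   longer than |A| forces exactness. *)
have exact_xA : kexact y (edge_ideal e) #|A|.+1 (kbasis (mem A) 'X_[mA] (enum 'I_n)).
  apply: (wreg_kexact edge_ideal_ideal _ regfs) => //.
  - move=> f /mfs; exact: graded_maxideal_nilp.
  - by rewrite eqA; apply: kdeg_kbasis.
  - apply: kin_kdiff_kbasis => [|i iA]; first exact: edge_ideal_ideal.
    have [j jA eij] := domA i iA.
    have [m ->] : exists m, mA = (U_(j) + m)%MM by apply: mnm_factor; rewrite mnmE jA.
    rewrite mpolyXD /y expr2 mulrACA mulrC; apply: (idealMl edge_ideal_ideal).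
    by apply: mem_ideal_gen; exists i, j.
(* Exactness would put x_A in the monomial ideal of the edges and squares, but A is independent and
   x_A is squarefree. *)
suff /mono_idealX : mono_ideal (K := K) U 'X_[mA].
  case/orP=> [/edge_or_inP[i]|/existsP[i]]; rewrite mnmE; last by case: (i \in A).
  rewrite lt0b => iA; rewrite inE => -[//|[j eij]].
  by rewrite mnmE lt0b => jA; have := indA _ _ iA jA; rewrite eij.
have idU : is_ideal (mono_ideal (K := K) U) by exact: mono_ideal_ideal.
apply: (kexact_kbasis idU _ _ exact_xA) => [p|i iA].
  move/(edge_idealE irr_e); apply: sub_all => m mI; by apply/orP; left.
rewrite /y mpolyXn; apply/mono_idealX/orP; right; apply/existsP; exists i.
by rewrite mulmnE mnm1E eqxx.
Qed.

Lemma hsyms_maxideal t f : f \in hsyms K n t -> graded_maxideal f.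
Proof.
case/mapP=> j; rewrite mem_iota => /andP[+ _] ->; case: j => // j _.
have idm : is_ideal (@graded_maxideal K n) by apply: ideal_gen_ideal.
elim: (enum _) j => [|i l IH] j; first exact: (ideal0 idm).
rewrite map_cons hsym_consS; apply: (idealD idm); first exact: IH.
by apply: (idealMr idm); apply: mem_ideal_gen; exists i.
Qed.

Lemma graded_maxideal1 : ~ @graded_maxideal K n 1.
Proof.
pose U (m : 'X_{1..n}) := m != 0%MM.
have upU : upclosed U.
  by move=> m1 m2; apply: contraNneq => /eqP; rewrite mnmD_eq0 => /andP[].
move=> m1; suff : mono_ideal (K := K) U 1 by rewrite /mono_ideal msupp1 /= /U eqxx.
apply: ideal_gen_sub m1 => [|p [i ->]]; first exact: mono_ideal_ideal.
by apply/mono_idealX; rewrite /U mnm1_eq0.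
Qed.

Lemma regular_hsyms t : wreg (edge_var_ideal (K := K) e set0) (hsyms K n t) ->
  regular_seq_quot (edge_ideal e) (hsyms K n t).
Proof.
move=> regh; split.
  apply/(wregP _ edge_ideal_ideal); apply: wreg_ext regh => p.
  by apply: iff_sym; apply: edge_idealE.
have idm : is_ideal (@graded_maxideal K n) by apply: ideal_gen_ideal.
move=> I1; apply: graded_maxideal1.
apply: (ideal_gen_sub idm) I1 => p [|/hsyms_maxideal //].
apply: (ideal_gen_sub idm) => q [i [j [_ ->]]]; apply: (idealMl idm).
by apply: mem_ideal_gen; exists j.
Qed.

(** The bounds t and |A| differ by at most one, so the depth is settled by a classical case
    distinction: does a regular sequence of length |A| exist? *)
Lemma depth_quot_edge_ideal A t :
    {in A &, forall i j, ~~ e i j} ->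
    (forall i, i \notin A -> exists2 j, j \in A & e i j) ->
    wreg (edge_var_ideal (K := K) e set0) (hsyms K n t) -> (#|A| <= t.+1)%N ->
  exists2 d, (t <= d <= #|A|)%N &
    depth_quot (@graded_maxideal K n) (edge_ideal e) d.
Proof.
move=> indA domA regh leAt; have regt := regular_hsyms regh.
have szh : size (hsyms K n t) = t by rewrite size_map size_iota.
have ubA := regular_seq_leq_dominating indA domA.
have letA : (t <= #|A|)%N by rewrite -szh; apply: ubA regt => f; apply: hsyms_maxideal.
have [[fs [szfs mfs regfs]]|nofs] := classic (exists fs : seq {mpoly K[n]},
  [/\ size fs = #|A|, forall f, f \in fs -> graded_maxideal f
    & regular_seq_quot (edge_ideal e) fs]).
  by exists #|A|; [rewrite letA leqnn | split; [exists fs | exact: ubA]].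
exists t; first by rewrite leqnn.
split; first by exists (hsyms K n t); split=> // f; apply: hsyms_maxideal.
move=> fs mfs regfs; have := ubA fs mfs regfs; rewrite leq_eqVlt => /orP[/eqP szA|].
  by case: nofs; exists fs.
by move=> ltA; rewrite -ltnS (leq_trans ltA).
Qed.

(** The vertices of [W] are deleted one by one; each deletion also leaves a colon branch, in which w
    is kept and its neighbours are adjoined. *)
Lemma wreg_delete (W : {set 'I_n}) fs :
    wreg (edge_var_ideal (K := K) e W) fs ->
    (forall (D : {set 'I_n}) w, D \subset W -> w \in W -> w \notin D ->
       wreg (edge_var_ideal (K := K) e (D :|: nbhd e w)) fs) ->
  wreg (edge_var_ideal (K := K) e set0) fs.
Proof.
move=> regW regN; suff regD (D : {set 'I_n}) :
    D \subset W -> wreg (edge_var_ideal (K := K) e D) fs.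
  exact/regD/sub0set.
have [s] := ubnP #|W :\: D|; elim: s D => // s IH D ltDs DW.
have [eqDW|neDW] := eqVneq D W; first by rewrite eqDW.
have /properP[_ [w wW wD]] : D \proper W by rewrite properEneq neDW.
apply: (wreg_colon_adjoin (x := 'X_w)); first exact: edge_var_ideal_ideal.
- apply: wreg_ext (fun p => iff_sym (colon_edge_var_ideal sym_e irr_e p wD)) _.
  exact: regN.
- apply: wreg_ext (fun p => iff_sym (adjoin_edge_var_ideal (K := K) e D w p)) _.
  apply: IH; last by rewrite subUset sub1set wW.
  rewrite -ltnS; apply: leq_trans ltDs; rewrite ltnS; apply: proper_card.
  apply/properP; split; first by rewrite setDS // subsetUr.
  by exists w; rewrite !inE ?wW ?wD ?eqxx.
Qed.

End DepthBounds.

(** * Powers of cycles *)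

Lemma cycle_power_sym n k i j : cycle_power n k i j = cycle_power n k j i.
Proof. by rewrite /cycle_power orbC. Qed.

Lemma cycle_power_irr n k : irreflexive (cycle_power n k).
Proof. by move=> i; rewrite /cycle_power ltnn. Qed.

Lemma muln_sep b j1 j2 :
  (j1 * b < j2 * b + b)%N -> (j2 * b < j1 * b + b)%N -> j1 = j2.
Proof.
rewrite -!mulSnr !ltn_mul2r !ltnS => /andP[_ le12] /andP[_ le21].
by apply/eqP; rewrite eqn_leq le12 le21.
Qed.

Section CyclePower.
Local Open Scope nat_scope.
Variables (n k : nat).
Local Notation e := (cycle_power n.+1 k).
Local Notation b := (2 * k + 1).

Lemma cycle_power_near (u c : 'I_n.+1) : (u == c) || e u c ->
  u + k < c + n.+1 -> c + k < u + n.+1 -> u <= c + k /\ c <= u + k.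
Proof. by rewrite -val_eqE /cycle_power /=; lia. Qed.

Lemma packing_path t : t.-1 * b + k < n.+1 ->
  exists2 C : {set 'I_n.+1},
    packing e [set i : 'I_n.+1 | n.+1 - k <= i] C & #|C| = t.
Proof.
move=> ltn; pose f (j : 'I_t) : 'I_n.+1 := inord (j * b).
have fE j : f j = j * b :> nat /\ j * b + k < n.+1.
  have : j * b + k < n.+1.
    apply: leq_ltn_trans ltn; rewrite leq_add2r leq_mul2r.
    by apply/orP; right; have := ltn_ord j; lia.
  by move=> ltj; rewrite inordK //; lia.
exists [set f j | j : 'I_t].
  split=> [_ /imsetP[j _ ->]|u _ _ uD /imsetP[j1 _ ->] /imsetP[j2 _ ->]].
    by rewrite inE; have := fE j; lia.
  rewrite inE in uD; have [E1 lt1] := fE j1; have [E2 lt2] := fE j2.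
  move=> /cycle_power_near u1 /cycle_power_near u2.
  have [le1 ge1] : u <= f j1 + k /\ f j1 <= u + k by apply: u1; lia.
  have [le2 ge2] : u <= f j2 + k /\ f j2 <= u + k by apply: u2; lia.
  suff -> : j1 = j2 by [].
  by apply: val_inj; apply: (@muln_sep b) => /=; lia.
rewrite card_imset ?card_ord // => j1 j2 /(congr1 val) /=.
have [-> _] := fE j1; have [-> _] := fE j2 => E.
by apply: val_inj; apply: (@muln_sep b) => /=; lia.
Qed.

(** One member is w, whose closed neighbourhood has 2k+1 vertices; the other n+1 - (2k+1) vertices
    form an interval with room for t-1 members spaced by 2k+1, the first at its left end. *)
Lemma packing_nbhd_cycle t (D : {set 'I_n.+1}) (w : 'I_n.+1) :
    2 * k + 2 <= n.+1 -> t.-1 * b < n.+1 -> n.+1 - k <= w -> w \notin D ->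
    {in D, forall i : 'I_n.+1, n.+1 - k <= i} ->
  exists2 C, packing e (D :|: nbhd e w) C & #|C| = t.
Proof.
(* The vertices outside the closed neighbourhood of [w] are those of the interval
   [w + k + 1 - n.+1, w - k - 1], where adjacency does not wrap around. *)
move=> len ltn lew wD leD.
have [a aE] : {a | a = w + k + 1 - n.+1} by exists (w + k + 1 - n.+1).
pose f (j : 'I_t) : 'I_n.+1 := if (j : nat) is j'.+1 then inord (a + j' * b) else w.
have fE (j : 'I_t) :
    if (j : nat) is j'.+1 then f j = a + j' * b :> nat /\ a + j' * b + k < w
    else f j = w.
  rewrite /f; case: (nat_of_ord j) (ltn_ord j) => // j' ltj.
  have : a + j' * b + k < w.
    have : j'.+1 * b <= t.-1 * b.
      by rewrite leq_mul2r; apply/orP; right; lia.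
    by rewrite mulSn; lia.
  by move=> ltj'; rewrite inordK //; have := ltn_ord w; lia.
have ltw := ltn_ord w.
exists [set f j | j : 'I_t].
  split=> [_ /imsetP[j _ ->]|u _ _ uD /imsetP[j1 _ ->] /imsetP[j2 _ ->]].
    have := fE j; case: (nat_of_ord j) => [->|j' [E lt]].
      by rewrite !inE (negPf wD) cycle_power_irr.
    rewrite !inE negb_or; apply/andP; split.
      by apply/negP => /leD; lia.
    by rewrite /cycle_power /= E; lia.
  have euw : e u w = false.
    by move: uD; rewrite !inE negb_or cycle_power_sym => /andP[_ /negPf].
  have leu : a <= u <= w.
    by move: euw; rewrite /cycle_power /=; have := ltn_ord u; lia.
  have near x (c : 'I_n.+1) : c = a + x :> nat -> a + x + k < w ->
      (u == c) || e u c -> a + x <= u + k /\ u <= a + x + k.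
    by move=> E lt /cycle_power_near; rewrite E => -[]; lia.
  have far x (c : 'I_n.+1) : c = a + x :> nat -> a + x + k < w ->
      u = w -> (u == c) || e u c -> False.
    by move=> E lt uw /(near _ _ E lt); rewrite uw; lia.
  have := fE j1; have := fE j2.
  case E2: (nat_of_ord j2) => [|j2']; case E1: (nat_of_ord j1) => [|j1'].
  - by move=> -> ->.
  - by move=> -> [F1 lt1] u1; rewrite euw orbF => /eqP /(far _ _ F1 lt1).
  - by move=> [F2 lt2] ->; rewrite euw orbF => /eqP uw /(far _ _ F2 lt2 uw).
  move=> [F2 lt2] [F1 lt1] /(near _ _ F1 lt1) u1 /(near _ _ F2 lt2) u2.
  suff -> : j1 = j2 by [].
  apply/val_inj; rewrite /= E1 E2; congr _.+1.
  by apply: (@muln_sep b); lia.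
rewrite card_imset ?card_ord // => j1 j2 E.
apply: val_inj; move: E => /(congr1 val) /=; have := fE j1; have := fE j2.
case: (nat_of_ord j2) => [|j2']; case: (nat_of_ord j1) => [|j1'] //=.
- by move=> -> [-> ?]; lia.
- by move=> [-> ?] ->; lia.
by move=> [-> ?] [-> ?] E; congr _.+1; apply: (@muln_sep b); lia.
Qed.

(** Deleting all of the last k vertices leaves a path, and this branch uses the extra k in the
    bound; keeping one of them leads to [packing_nbhd_cycle]. *)
Lemma wreg_cycle_power (K : fieldType) t : 2 * k + 2 <= n.+1 -> t.-1 * b + k < n.+1 ->
  wreg (edge_var_ideal (K := K) e set0) (hsyms K n.+1 t).
Proof.
move=> len ltn; have [sym irr] := (@cycle_power_sym n.+1 k, @cycle_power_irr n.+1 k).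
apply: (wreg_delete sym irr (W := [set i : 'I_n.+1 | n.+1 - k <= i])).
  have [C packC cardC] := packing_path ltn.
  by apply: (wreg_packing K sym irr packC); rewrite cardC.
move=> D w /subsetP DW; rewrite inE => lew wD.
have [|i /DW|C packC cardC] := @packing_nbhd_cycle t D w len _ lew wD.
- exact: leq_ltn_trans (leq_addr _ _) ltn.
- by rewrite inE.
by apply: (wreg_packing K sym irr packC); rewrite cardC.
Qed.

(** Around the cycle, gaps of at least k+1 give independence and gaps of at most 2k+1 give
    domination. The last two gaps add up to a number between 2k+2 and 4k+2, so halving respects both
    bounds. *)
Lemma dominating_cycle_power c : 2 * k + 2 <= n.+1 -> 1 < c ->
    (c.-1 * b < n.+1) -> n.+1 <= c * b ->
  exists A : {set 'I_n.+1}, [/\ #|A| <= c, {in A &, forall i j, ~~ e i j}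
    & forall i, i \notin A -> exists2 j, j \in A & e i j].
Proof.
move=> len; case: c => [|[|c]] // _ /= ltn len2.
(* The gaps are all equal to [b], except that the last two, which add up to
   [n.+1 - c * b], are halved. *)
pose L := c * b + (n.+1 - c * b)./2.
pose f (j : 'I_c.+2) : 'I_n.+1 := inord (if j <= c then j * b else L).
have leM j : j <= c -> j * b <= c * b by move=> lejc; rewrite leq_mul2r lejc orbT.
have [leL ltL] : c * b + k.+1 <= L <= c * b + b /\ L + k.+1 <= n.+1 <= L + b.
  by rewrite /L; move: ltn len2; rewrite !mulSn; move: (c * b) => M; lia.
have fE (j : 'I_c.+2) : f j = (if j <= c then j * b else L) :> nat.
  by rewrite /f inordK //; case: ifP => [/leM|_]; lia.
pose A := [set f j | j : 'I_c.+2].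
have mulA q : q <= c -> exists2 i : 'I_n.+1, i \in A & i = q * b :> nat.
  move=> leqc; exists (f (inord q)); first exact: imset_f.
  by rewrite fE inordK ?leqc //; lia.
have LA : exists2 i : 'I_n.+1, i \in A & i = L :> nat.
  by exists (f ord_max); [exact: imset_f | rewrite fE /= ltnn].
exists A; split.
- by apply: leq_trans (leq_imset_card _ _) _; rewrite card_ord.
- move=> _ _ /imsetP[j1 _ ->] /imsetP[j2 _ ->]; rewrite /cycle_power /= !fE.
  case: ifP => [le1|_]; case: ifP => [le2|_]; last 3 first.
  + by have := leM _ le1; lia.
  + by have := leM _ le2; lia.
  + by lia.
  have le1' := leM _ le1; have le2' := leM _ le2.
  have [lt12|lt21|->] := ltngtP (j1 : nat) j2; last by lia.
  + by have : j1.+1 * b <= j2 * b; [rewrite leq_mul2r lt12 orbT | lia].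
  + by have : j2.+1 * b <= j1 * b; [rewrite leq_mul2r lt21 orbT | lia].
move=> i iA; have ltin := ltn_ord i.
have adj (j : 'I_n.+1) : j \in A ->
    (i <= j + k) && (j <= i + k) || (n.+1 + j <= i + k) -> exists2 j, j \in A & e i j.
  move=> jA near; exists j => //; have : i != j :> nat.
    by apply: contraNneq iA => /val_inj ->.
  by rewrite /cycle_power /=; lia.
have [leiM|ltMi] := leqP i (c * b + k).
  (* This makes q b the multiple of b nearest to i. *)
  pose q := (i + k) %/ b; have [leqi ltqi] : q * b <= i + k /\ i + k < q * b + b.
    rewrite -mulSnr leq_divM; split=> //; apply: ltn_ceil; lia.
  have [|j jA jE] := mulA q; first by rewrite /q -ltnS ltn_divLR ?mulSn; lia.
  by apply: (adj j) => //; rewrite jE; lia.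
have [leiL|ltLi] := leqP i (L + k).
  by have [j jA jE] := LA; apply: (adj j) => //; rewrite jE; lia.
have [//|j jA jE] := mulA 0; apply: (adj j) => //; rewrite jE; lia.
Qed.

End CyclePower.

(** * Ceilings and the final case distinction *)

Lemma ceil_fracE n c b : (0 < b)%N -> (c * b < n)%N -> (n <= c.+1 * b)%N ->
  ceil_frac n b = c.+1%:Z.
Proof.
move=> b0 ltcn lenc; apply: ceil_def.
have b0' : 0 < b%:R :> rat by rewrite ltr0n.
rewrite ltr_pdivlMr // ler_pdivrMr // intS addrC addKr -!pmulrn -!natrM.
by rewrite ltr_nat ler_nat ltcn lenc.
Qed.

Theorem corollary4p5 (K : fieldType) (n k : nat) (hk : (1 <= k)%N)
    (hn : (3 <= n)%N) :
  let m := @graded_maxideal K n in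
  let I := @edge_ideal K n (cycle_power n k) in
  let c := ceil_frac n (2 * k + 1) in
  let r := (n %% (2 * k + 1))%N in
  ((n <= 2 * k + 1)%N -> depth_quot m I 1) /\
  ((2 * k + 2 <= n)%N ->
     ((r = 0%N \/ (k + 1 <= r <= 2 * k)%N) ->
        exists d : nat, depth_quot m I d /\ (d%:Z = c)%R) /\
     ((1 <= r <= k)%N ->
        exists d : nat, depth_quot m I d /\ (c - 1 <= d%:Z <= c)%R)).
Proof.
case: n hn => // n hn m I c r.
have [sym irr] := (@cycle_power_sym n.+1 k, @cycle_power_irr n.+1 k).
split=> len.
  (* The graph is complete, and a single vertex serves both as maximal independent set and as
     packing. *)
  have [||||d d1 depthd] := @depth_quot_edge_ideal K _ _ irr [set ord0] 1.
  - by move=> i j; rewrite !inE => /eqP -> /eqP ->; rewrite irr.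
  - move=> i; rewrite inE => ni0; exists ord0; rewrite ?inE //.
    move: ni0; rewrite -val_eqE /cycle_power /=; have := ltn_ord i; lia.
  - apply: (wreg_packing K sym irr (C := [set ord0])); last by rewrite cards1.
    split=> [i|u c1 c2 _]; first by rewrite !inE.
    by rewrite !inE => /eqP -> /eqP ->.
  - by rewrite cards1.
  by move: d1 depthd; rewrite cards1 -eqn_leq => /eqP <-.
have eqn : n.+1 = (n.+1 %/ (2 * k + 1) * (2 * k + 1) + r)%N by exact: divn_eq.
have ltr : (r < 2 * k + 1)%N by rewrite ltn_mod; lia.
move: (n.+1 %/ _)%N eqn => q eqn.
have depth t s : (t.-1 * (2 * k + 1) + k < n.+1)%N -> (0 < s)%N ->
    (s * (2 * k + 1) < n.+1 <= s.+1 * (2 * k + 1))%N -> (s <= t)%N ->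
    exists2 d, (t <= d <= s.+1)%N & depth_quot m I d /\ c = s.+1%:Z.
  move=> ltt s0 /andP[lts les] lest.
  have [A [leA indA domA]] := dominating_cycle_power (c := s.+1) len s0 lts les.
  have [||||d led depthd] := @depth_quot_edge_ideal K _ _ irr A t.
  - exact: indA.
  - exact: domA.
  - exact: wreg_cycle_power.
  - exact: leq_trans leA _.
  exists d; first by case/andP: led => -> /leq_trans ->.
  by split=> //; apply: ceil_fracE lts les; rewrite addn1.
split=> [[r0|/andP[ltkr _]]|/andP[r0 lerk]].
(* For r = 0 and for r > k, t can be the ceiling: n exceeds (ceiling - 1)(2k+1) by 2k+1 or by r, in
   both cases by more than k. *)
- case: q eqn => [|[|q]]; rewrite r0 ?mulSn; [lia | lia | move=> eqn].
  have [||||d led [depthd ->]] := depth q.+2 q.+1; rewrite /= ?mulSn; try lia.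
  by exists d; split=> //; congr Posz; lia.
- case: q eqn => [|q]; rewrite ?mulSn; [lia | move=> eqn].
  have [||||d led [depthd ->]] := depth q.+2 q.+1; rewrite /= ?mulSn; try lia.
  by exists d; split=> //; congr Posz; lia.
(* Now r <= k, so the inequality on t fails at the ceiling and t is one less. *)
- case: q eqn => [|q]; rewrite ?mulSn; [lia | move=> eqn].
  have [||||d led [depthd ->]] := depth q.+1 q.+1; rewrite /= ?mulSn; try lia.
  by exists d; split=> //; lia.
Qed.
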